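(* Define $p_1:=0$ and $p_k:=\frac{2\log(1+1/k)}{\log(1+2/(k-1))}$ for integers $k\ge 2$. For $p\in (p_{k-1},p_k]$, define $\tau(p):=k^{1-2/p}\cdot (k-1)$. Then for $p\in(0,1)$ and $\beta>0$, \[ \lim_{n\to\infty}n^{1-2/p}\log \mathcal{Z}_{n,p}(\beta) = \frac{\beta}{2}\tau(p). \]
   Context: For $p>0$ let $\rho_p(x)=c_p e^{-|x|^p/p}$, $x\in\mathbb{R}$, with $c_p=\frac{p^{-1/p}}{2\Gamma(1+1/p)}$. Let $S_{n,p}:=\{\sigma\in\mathbb{R}^n: \frac1n\sum_{i=1}^n|\sigma_i|^p=1\}$ with the uniform probability measure $d_{n,p}\sigma$ (the law of $X/\|X\|_{n,p}$ with $X_1,\dots,X_n$ i.i.d. $\rho_p$, $\|x\|_{n,p}=(\frac1n\sum_i|x_i|^p)^{1/p}$). With $H_n(\sigma)=\frac1n\sum_{i<j}\sigma_i\sigma_j$, the partition function is $\mathcal{Z}_{n,p}(\beta)=\int_{S_{n,p}}\exp(\beta H_n(\sigma))\,d_{n,p}\sigma$. *)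

(* Defs.v *)
From HB Require Import structures.
From mathcomp Require Import all_boot all_order all_algebra.
From mathcomp Require Import all_classical all_reals all_analysis.
Set Implicit Arguments. Unset Strict Implicit. Unset Printing Implicit Defensive.
Import Order.TTheory GRing.Theory Num.Theory.
Import numFieldNormedType.Exports.
Local Open Scope classical_set_scope.
Local Open Scope ring_scope.

Section Defs.
Variable R : realType.

Definition Gamma (s : R) : R :=
  fine (\int[@lebesgue_measure R]_(t in `]0%R, +oo[) ((t `^ (s - 1)) * expR (- t))%:E)%E.

Definition c_p (p : R) : R := p `^ (- (1 / p)) / (2 * Gamma (1 + 1 / p)).

Definition rho (p x : R) : R := c_p p * expR (- (`|x| `^ p) / p).

(* ||x||_{n,p} = ((1/n) sum_{i<n} |x_i|^p)^(1/p) ; vectors are x : nat -> R,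
   only coordinates 0..n-1 are used *)
Definition lpnorm (n : nat) (p : R) (x : nat -> R) : R :=
  ((\sum_(i < n) `|x i| `^ p) / n%:R) `^ (1 / p).

Definition Hn (n : nat) (s : nat -> R) : R :=
  (\sum_(i < n) \sum_(j < n | (i < j)%N) s i * s j) / n%:R.

(* Iterated Lebesgue integral over R^k of F, coordinates 0..k-1 integrated
   (coordinate k-1 outermost). *)
Fixpoint iter_int (k : nat) (F : (nat -> R) -> \bar R) : \bar R :=
  match k with
  | O => F (fun _ => 0)
  | k'.+1 => (\int[@lebesgue_measure R]_t
               iter_int k' (fun x => F (fun i => if i == k' then t else x i)))%E
  end.

(* Z_{n,p}(beta) = E[ exp(beta H_n(X/||X||_{n,p})) ], X_1..X_n iid with density rho_p *)
Definition Znp (n : nat) (p beta : R) : \bar R :=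
  iter_int n (fun x =>
    (expR (beta * Hn n (fun i => x i / lpnorm n p x)) * \prod_(i < n) rho p (x i))%:E).

Definition pk (k : nat) : R :=
  if (k <= 1)%N then 0
  else 2 * ln (1 + 1 / k%:R) / ln (1 + 2 / (k%:R - 1)).

(* tau(p) = k^(1-2/p) (k-1), for p in (p_{k-1}, p_k] *)
Definition tau_k (k : nat) (p : R) : R := k%:R `^ (1 - 2 / p) * (k%:R - 1).

End Defs.

Arguments Gamma {R}.
Arguments c_p {R}.
Arguments rho {R}.
Arguments lpnorm {R}.
Arguments Hn {R}.
Arguments iter_int {R}.
Arguments Znp {R}.
Arguments pk {R}.
Arguments tau_k {R}.

(* Main.v *)
Require Import Defs.
From HB Require Import structures.
From mathcomp Require Import all_boot all_order all_algebra.
From mathcomp Require Import all_classical all_reals all_analysis.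
From mathcomp Require Import measurable_realfun.
From mathcomp Require Import ring lra.
Import Order.TTheory GRing.Theory Num.Theory.
Import numFieldNormedType.Exports.
Local Open Scope classical_set_scope.
Local Open Scope ring_scope.

(* On the sphere |H_n| is of order n^(2/p-1), which for p < 1 beats n, while the
   product density only contributes exp(O(n)) factors.  Hence [ln Z] is governed
   by the maximum of [sum_(i<j) u_i u_j] over [sum_i |u_i|^p = 1].

   With x_i = |u_i|^p on the simplex, fix all but two coordinates: an unequal
   positive pair is strictly improved either by averaging the pair or by merging
   it into one coordinate.  So at a maximizer the nonzero coordinates are all
   equal, and with m of them the value is [tau_k m p / 2].  Since [ln (tau_k x p)]
   is concave in [ln x], the best m is found by comparing neighbours, which is
   what p_{k-1} < p <= p_k expresses.

   For the lower bound on Z, k coordinates are put near T = n^(1/p^2) and the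
   others in [0, 1].  The cost of this box is exp(O(n^(1/p) + n)) = exp(o(n^(2/p-1))),
   and its normalized points approach the optimizer because T^p = n^(1/p) >> n. *)

(** * The two-coordinate inequality *)

(** With y = e^z, adding (q-1) times 1 - z < e^(-z) to 1 + (q-1)z < e^((q-1)z) cancels z and leaves
    q on the left; multiplying by y gives the claim. *)
Lemma bernoulli_powR (R : realType) (q y : R) :
  1 < q -> 0 < y -> y != 1 -> 1 + q * (y - 1) < y `^ q.
Proof.
move=> q1 y0 y1; have [z zE] : exists z, y = expR z by exists (ln y); rewrite lnK.
have z0 : z != 0 by apply: contra y1 => /eqP z0; rewrite zE z0 expR0.
have e1 : 1 - z < expR (- z) by apply: expR_gt1Dx; rewrite oppr_eq0.
have e2 : 1 + (q - 1) * z < expR ((q - 1) * z).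
  by apply: expR_gt1Dx; rewrite mulf_neq0// subr_eq0 gt_eqF.
have -> : y `^ q = y * expR ((q - 1) * z).
  by rewrite zE -expRM -expRD; congr expR; ring.
have : y * q < y * ((q - 1) * expR (- z) + expR ((q - 1) * z)).
  by rewrite ltr_pM2l//; nra.
by rewrite mulrDr mulrCA {2}zE -expRD subrr expR0 mulr1; lra.
Qed.

Lemma powR_tangent_lt (R : realType) (q x y : R) :
  1 < q -> 0 < x -> 0 < y -> x != y ->
  y `^ q + q * y `^ (q - 1) * (x - y) < x `^ q.
Proof.
move=> q1 x0 y0 xy; have xy0 : 0 < x / y by rewrite divr_gt0.
have xy1 : x / y != 1.
  by apply: contra xy => /eqP e; rewrite -(divfK (lt0r_neq0 y0) x) e mul1r.
have := bernoulli_powR _ _ _ q1 xy0 xy1.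
rewrite -(@ltr_pM2r _ (y `^ q)) ?powR_gt0//.
rewrite -powRM ?(ltW xy0) ?(ltW y0)// divfK ?gt_eqF//; apply: le_lt_trans.
have -> : y `^ q = y * y `^ (q - 1) by rewrite mulr_powRB1 ?ltW//; lra.
by rewrite le_eqVlt; apply/orP; left; apply/eqP; field; rewrite gt_eqF.
Qed.

(** By strict convexity, the slope of the chord of t^q from t to 1 increases with t. Both points 1
    and b are compared with the tangent at a, which lies between them. *)
Lemma powR_slope_lt (R : realType) (q a b : R) : 1 < q -> 0 < b -> b < a -> a < 1 ->
  (1 - b `^ q) * (1 - a) < (1 - a `^ q) * (1 - b).
Proof.
move=> q1 b0 ba a1; have a0 : 0 < a by lra.
have t1 := powR_tangent_lt _ _ 1 a q1 ltr01 a0 (negbT (gt_eqF a1)).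
have t2 := powR_tangent_lt _ _ b a q1 b0 a0 (negbT (lt_eqF ba)).
rewrite powR1 in t1.
have : 0 < (a - b) * (1 - (a `^ q + q * a `^ (q - 1) * (1 - a))).
  by rewrite mulr_gt0 ?subr_gt0.
have : 0 < (1 - a) * (b `^ q - (a `^ q + q * a `^ (q - 1) * (b - a))).
  by rewrite mulr_gt0 ?subr_gt0.
lra.
Qed.

Lemma powR_continuous (R : realType) (r x : R) :
  0 < x -> {for x, continuous (fun t : R => t `^ r)}.
Proof.
move=> x0; apply: differentiable_continuous; apply/derivable1_diffP.
by apply: ex_derive; exact: is_derive1_powR.
Qed.

(** The right-hand side is symmetric under a -> 1 - a and equals the left-hand side at a = 1/2. To
    the right of 1/2 its derivative is positive: up to positive factors, it is the slope comparison
    of [powR_slope_lt] at 1 - x < x. *)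
Lemma powRN_product_min (R : realType) (q a : R) : 1 < q -> 2^-1 < a -> a < 1 ->
  (2 `^ q - 1) ^+ 2 < (a `^ (- q) - 1) * ((1 - a) `^ (- q) - 1).
Proof.
move=> q1 a2 a1.
pose M (x : R) := (x `^ (- q) - 1) * ((1 - x) `^ (- q) - 1).
pose dM (x : R) := q * (x `^ (- q) * (1 - x) `^ (- q) *
   (((1 - x `^ q) * x - (1 - (1 - x) `^ q) * (1 - x)) / (x * (1 - x)))).
have M12 : M 2^-1 = (2 `^ q - 1) ^+ 2.
  rewrite /M (_ : 1 - 2^-1 = 2^-1 :> R); last by lra.
  by rewrite -powR_inv1// -powRrM mulN1r opprK expr2.
have dMP x : x \in `]2^-1, a[%R -> is_derive x 1 M (dM x).
  rewrite in_itv/= => /andP[x2 xa].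
  have x0 : 0 < x by lra.
  have x1 : 0 < 1 - x by lra.
  have d1 : is_derive x 1 (fun x : R => 1 - x) (- 1).
    have := is_deriveB (is_derive_cst (1 : R) x 1) (is_derive_id x 1).
    by rewrite sub0r.
  have d2 := is_derive1_powR (- q) x0.
  have d3 := @is_derive1_comp _ _ (fun t : R => 1 - t) _ _ _
    (is_derive1_powR (- q) x1) d1.
  have d4 := is_deriveB d2 (is_derive_cst (1 : R) x 1).
  have d5 := is_deriveB d3 (is_derive_cst (1 : R) x 1).
  apply: (eq_rect _ (fun d => is_derive x 1 M d) (is_deriveM d4 d5)).
  rewrite /dM !subr0 /GRing.scale !fctE /= .
  rewrite !powRB ?(gt_eqF x0) ?(gt_eqF x1) ?implybT// !powRr1 ?ltW// !powRN.
  have u0 : x `^ q != 0 by rewrite gt_eqF// powR_gt0.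
  have v0 : (1 - x) `^ q != 0 by rewrite gt_eqF// powR_gt0.
  by field; rewrite u0 v0 !gt_eqF.
have dMgt x : x \in `]2^-1, a[%R -> 0 < dM x.
  rewrite in_itv/= => /andP[x2 xa].
  have x0 : 0 < x by lra.
  have x1 : 0 < 1 - x by lra.
  apply: mulr_gt0; first by lra.
  apply: mulr_gt0; first by rewrite mulr_gt0 ?powR_gt0.
  apply: divr_gt0; last by rewrite mulr_gt0.
  have := powR_slope_lt _ _ x (1 - x) q1 x1.
  by move=> /(_ ltac:(lra) ltac:(lra)); lra.
have [|c cI E] := @MVT _ M dM 2^-1 a a2 dMP.
  apply: continuous_in_subspaceT => x; rewrite inE/= in_itv/= => /andP[x2 xa].
  have x0 : 0 < x by lra.
  have x1 : 0 < 1 - x by lra.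
  apply: cvgM; apply: cvgB; try exact: cvg_cst.
    exact: powR_continuous.
  apply: (@continuous_comp _ _ _ (fun t : R => 1 - t) (fun t : R => t `^ (- q))).
    by apply: cvgB; [exact: cvg_cst|exact: cvg_id].
  exact: powR_continuous.
rewrite -M12 -subr_gt0 -/(M a) E mulr_gt0 ?dMgt//; lra.
Qed.

(** Clearing denominators in [powRN_product_min] gives (1 - a^q)(1 - b^q) > (2^q - 1)^2 (ab)^q; one
    term (ab)^q cancels on expansion. *)
Lemma powR_simplex2_lt (R : realType) (q a b : R) :
  1 < q -> 0 < a -> 0 < b -> a + b = 1 -> a != b ->
  (4 `^ q - 2 * 2 `^ q) * (a `^ q * b `^ q) < 1 - a `^ q - b `^ q.
Proof.
move=> q1; wlog ba : a b / b < a => [H|].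
  move=> a0 b0 ab1 ab; case: (ltrgtP b a) => [ba|ab'|]; first exact: H.
    rewrite [a `^ q * _]mulrC [ltRHS]addrAC; apply: H => //; last by rewrite eq_sym.
    by rewrite addrC.
  by move/esym/eqP; rewrite (negbTE ab).
move=> a0 b0 ab1 _.
have := powRN_product_min _ q a q1 ltac:(lra) ltac:(lra).
have -> : 1 - a = b by lra.
have A0 : 0 < a `^ q by rewrite powR_gt0.
have B0 : 0 < b `^ q by rewrite powR_gt0.
rewrite !powRN -(@ltr_pM2r _ (a `^ q * b `^ q)) ?mulr_gt0//.
have -> : 4 `^ q = 2 `^ q * 2 `^ q :> R by rewrite -powRM//; congr (_ `^ _); lra.
rewrite (_ : ((a `^ q)^-1 - 1) * _ * _ = (1 - a `^ q) * (1 - b `^ q)); first by lra.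
by field; rewrite !gt_eqF.
Qed.

(* With [s = a + b], the value at [(a, b)] is dominated by the convex
   combination of the values at [(s/2, s/2)] and [(s, 0)] with weight
   [4^q (a b)^q / s^(2 q)] on the first. *)
Lemma pair_improvable (R : realType) (q a b W : R) :
  1 < q -> 0 < a -> 0 < b -> a != b -> 0 <= W ->
  let c := (a + b) / 2 in
  a `^ q * b `^ q + W * (a `^ q + b `^ q) < c `^ q * c `^ q + W * (c `^ q + c `^ q)
  \/ a `^ q * b `^ q + W * (a `^ q + b `^ q) < W * (a + b) `^ q.
Proof.
move=> q1 a0 b0 ab W0 c; set s := a + b.
have s0 : 0 < s by rewrite addr_gt0.
pose al := a / s; pose be := b / s.
have al0 : 0 < al by rewrite divr_gt0.
have be0 : 0 < be by rewrite divr_gt0.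
have albe : al + be = 1 by rewrite -mulrDl divff// gt_eqF.
have alNbe : al != be.
  by apply: contra ab => /eqP e; rewrite -(divfK (lt0r_neq0 s0) a) -/al e divfK// gt_eqF.
have := powR_simplex2_lt _ _ _ _ q1 al0 be0 albe alNbe.
have -> : a `^ q = s `^ q * al `^ q by rewrite -powRM ?ltW// mulrC divfK// gt_eqF.
have -> : b `^ q = s `^ q * be `^ q by rewrite -powRM ?ltW// mulrC divfK// gt_eqF.
have -> : c `^ q = s `^ q * (2 `^ q)^-1.
  by rewrite /c -/s powRM ?invr_ge0// ?ltW// -powR_inv1// -!powRN -powRrM mulN1r.
have E4 : 4 `^ q = 2 `^ q * 2 `^ q :> R by rewrite -powRM//; congr (_ `^ _); lra.
have T1 : 0 < 2 `^ q :> R by rewrite powR_gt0.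
(* Strict AM-GM, as [al] and [be] differ: it puts the weight [th] below 1. *)
have AB4 : 4 `^ q * (al `^ q * be `^ q) < 1.
  have lt1 : 4 * (al * be) < 1.
    have : 0 < (al - be) ^+ 2 by rewrite exprn_even_gt0//= subr_eq0.
    have -> : be = 1 - al by lra.
    by nra.
  have abge0 : 0 <= 4 * (al * be) by apply: mulr_ge0 => //; apply: mulr_ge0; exact: ltW.
  have := gt0_ltr_powR (lt_trans ltr01 q1) abge0 (ler01 : 1 \in Num.nneg) lt1.
  by rewrite powR1 powRM ?(mulr_ge0 (ltW al0) (ltW be0))// powRM ?ltW.
rewrite E4 in AB4 *.
set S := s `^ q; set A := al `^ q; set B := be `^ q; set T := 2 `^ q.
rewrite -/A -/B -/T in AB4 T1.
have S0 : 0 < S by rewrite powR_gt0.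
have A0 : 0 < A by rewrite powR_gt0.
have B0 : 0 < B by rewrite powR_gt0.
move=> K; pose th := T * T * (A * B).
have th0 : 0 < th by rewrite !mulr_gt0.
pose X := S * T^-1 * (S * T^-1) + W * (S * T^-1 + S * T^-1).
(* The strictness comes from the factor W. For W = 0 the two sides coincide, and averaging alone
   wins because [th] < 1. *)
have comb : S * A * (S * B) + W * (S * A + S * B) < th * X + (1 - th) * (W * S)
    \/ W = 0.
  have [->|Wn] := eqVneq W 0; [by right|left].
  have {Wn}W0 : 0 < W by rewrite lt_neqAle eq_sym Wn.
  have -> : th * X + (1 - th) * (W * S) =
    S * A * (S * B) + W * S * (1 - (T * T - 2 * T) * (A * B)).
    by rewrite /th /X; field; rewrite gt_eqF.
  by rewrite ltrD2l -mulrDr mulrA ltr_pM2l ?mulr_gt0//; lra.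
case: comb => [comb|W00].
  rewrite -/X.
  have [|XL] := ltP (S * A * (S * B) + W * (S * A + S * B)) X; first by left.
  right; rewrite ltNge; apply/negP => WL; move: comb; rewrite ltNge => /negP; apply.
  have h1 : th * X <= th * (S * A * (S * B) + W * (S * A + S * B)).
    by rewrite ler_pM2l.
  have h2 : (1 - th) * (W * S) <= (1 - th) * (S * A * (S * B) + W * (S * A + S * B)).
    by rewrite ler_pM2l// subr_gt0.
  lra.
left; rewrite W00 !mul0r !addr0.
have -> : S * T^-1 * (S * T^-1) = S * S / (T * T) by field; rewrite gt_eqF.
have S2 : 0 < S * S by rewrite mulr_gt0.
rewrite ltr_pdivlMr; last by rewrite mulr_gt0.
have -> : S * A * (S * B) * (T * T) = S * S * (T * T * (A * B)) by ring.
by rewrite gtr_pMr.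
Qed.

(** * Maximization on the simplex *)

(** The absolute value gives continuity on the whole line, so the extreme value theorem applies to a
    function defined on all row vectors. *)
Lemma continuous_powR_norm (R : realType) (q : R) :
  0 < q -> continuous (fun x : R => `|x| `^ q).
Proof.
move=> q0 x; have [->|x0] := eqVneq x 0.
  rewrite /continuous_at normr0 powR0 ?gt_eqF//.
  apply/cvgrPdist_lt => e e0.
  have := @nbhs0_lt R R _ (powR_gt0 q^-1 e0); apply: filterS => y ye.
  rewrite sub0r normrN ger0_norm ?powR_ge0//.
  have -> : e = (e `^ q^-1) `^ q by rewrite -powRrM mulVf ?gt_eqF// powRr1 ?ltW.
  by rewrite gt0_ltr_powR// ?nnegrE ?powR_ge0.
apply: (@continuous_comp _ _ _ (fun x : R => `|x|) (fun y : R => y `^ q)).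
  exact: norm_continuous.
by apply: powR_continuous; rewrite normr_gt0.
Qed.

(** Isolates the dependence on two coordinates: it is through u_i u_j + W (u_i + u_j), the quantity
    treated in [pair_improvable]. *)
Lemma sqr_sum_sub_pair (R : realType) (n : nat) (u : 'I_n -> R) (i j : 'I_n) :
  i != j ->
  (\sum_l u l) ^+ 2 - \sum_l u l ^+ 2 =
  (\sum_(l | (l != i) && (l != j)) u l) ^+ 2
   - \sum_(l | (l != i) && (l != j)) u l ^+ 2
  + 2 * (u i * u j + (\sum_(l | (l != i) && (l != j)) u l) * (u i + u j)).
Proof.
move=> ij.
have ji : j != i by rewrite eq_sym.
rewrite (bigD1 i)//= [X in _ - X](bigD1 i)//= (bigD1 j)//= [X in _ - (_ + X)](bigD1 j)//=.
ring.
Qed.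

Lemma replace_pair_sum (R : realType) (n : nat) (f : R -> R) (c : 'I_n -> R)
    (i j : 'I_n) (x y : R) : i != j ->
  let c' l := if l == i then x else if l == j then y else c l in
  \sum_(l | (l != i) && (l != j)) f (c' l) = \sum_(l | (l != i) && (l != j)) f (c l).
Proof.
by move=> ij c'; apply: eq_bigr => l /andP[li lj]; rewrite /c' (negbTE li) (negbTE lj).
Qed.

(** The hypothesis on [T] lists the values at the barycentres of the faces, m being the number of
    nonzero coordinates. A maximizer exists by compactness and must be such a barycentre. *)
Lemma simplex_pair_max (R : realType) (n : nat) (q T : R) : 1 < q ->
  (forall m : nat, (0 < m)%N -> m%:R * (m%:R - 1) * (m%:R^-1 `^ q) ^+ 2 <= T) ->
  forall x : 'I_n -> R, (forall i, 0 <= x i) -> \sum_i x i = 1 ->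
  (\sum_i x i `^ q) ^+ 2 - \sum_i (x i `^ q) ^+ 2 <= T.
Proof.
move=> q1 HT x x0 x1.
pose F (v : 'I_n -> R) := (\sum_i `|v i| `^ q) ^+ 2 - \sum_i (`|v i| `^ q) ^+ 2.
pose G (v : 'rV[R]_n) := F (fun i => v ord0 i).
have cB : compact [set v : 'rV[R]_n | forall i, v ord0 i \in `[0, 1]].
  apply: (@rV_compact R _ (fun=> `[0, 1]%classic)).
  by move=> _; apply: segment_compact.
set B := [set v | _] in cB.
pose A := B `&` [set v : 'rV[R]_n | \sum_i v ord0 i = 1].
have coordC (i : 'I_n) : continuous (fun v : 'rV[R]_n => v ord0 i).
  by move=> v; exact: coord_continuous.
have csum (f : 'I_n -> 'rV[R]_n -> R) : (forall i, continuous (f i)) ->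
    continuous (fun v => \sum_i f i v).
  by move=> fc; apply: continuous_big => // -[y z]; exact: add_continuous.
have clS : closed [set v : 'rV[R]_n | \sum_i v ord0 i = 1].
  apply: (@closed_comp _ _ (fun v : 'rV[R]_n => \sum_i v ord0 i) [set x | x = 1]).
    by move=> v _; apply: csum.
  exact: closed_eq.
have cA : compact A by exact: (compact_closedI cB clS).
have le1 (v : 'I_n -> R) : (forall i, 0 <= v i) -> \sum_i v i = 1 -> forall i, v i <= 1.
  move=> v0 <- i; rewrite (bigD1 i)//= lerDl; exact: sumr_ge0.
have AP (v : 'I_n -> R) : (forall i, 0 <= v i) -> \sum_i v i = 1 -> A (\row_i v i).
  move=> v0 v1; split=> [i|] /=.
    by rewrite mxE in_itv/= v0 le1.
  by rewrite -[RHS]v1; apply: eq_bigr => i _; rewrite mxE.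
have GC : continuous G.
  have pc (i : 'I_n) : continuous (fun v : 'rV[R]_n => `|v ord0 i| `^ q).
    move=> v; apply: (@continuous_comp _ _ _ (fun v : 'rV[R]_n => v ord0 i)
      (fun y : R => `|y| `^ q)); first exact: coordC.
    by apply: continuous_powR_norm; lra.
  have sc := csum _ pc.
  have qc i : continuous (fun v : 'rV[R]_n => (`|v ord0 i| `^ q) ^+ 2).
    by move=> v; exact: (continuousM (pc i v) (pc i v)).
  by move=> v; exact: (continuousB (continuousM (sc v) (sc v)) (csum _ qc v)).
have [c cA' cmax] : exists2 c, c \in A & forall t, t \in A -> G t <= G c.
  apply: compact_EVT_max => //; first by exists (\row_i x i); exact: AP.
  exact: continuous_subspaceT.
have [cI c1] : A c by rewrite inE in cA'.
rewrite /= in c1.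
pose d i := c ord0 i.
have d0 i : 0 <= d i by have := cI i; rewrite /= in_itv/= => /andP[].
have {}cmax (v : 'I_n -> R) : (forall i, 0 <= v i) -> \sum_i v i = 1 -> F v <= F d.
  move=> v0 v1; have := cmax (\row_i v i); rewrite inE => /(_ (AP _ v0 v1)).
  rewrite /G; congr (_ <= _); congr F.
  by apply/funext => i; rewrite mxE.
have Fpow v : (forall i, 0 <= v i) ->
    F v = (\sum_i v i `^ q) ^+ 2 - \sum_i (v i `^ q) ^+ 2.
  by move=> v0; rewrite /F; congr (_ ^+ 2 - _); apply: eq_bigr => i _;
    rewrite ger0_norm.
rewrite -Fpow//; apply: (le_trans (cmax x x0 x1)); rewrite Fpow//.
have eqd i j : 0 < d i -> 0 < d j -> d i = d j.
  move=> di dj; apply/eqP/negPn/negP => dij.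
  have ij : i != j by apply: contra dij => /eqP ->.
  have ji : j != i by rewrite eq_sym.
  pose W := \sum_(l | (l != i) && (l != j)) d l `^ q.
  have W0 : 0 <= W by apply: sumr_ge0 => l _; exact: powR_ge0.
  (* Maximality of [d]: sharing the mass d_i + d_j differently never increases the value. The two
     moves of [pair_improvable] contradict this. *)
  have repl a b : 0 <= a -> 0 <= b -> a + b = d i + d j ->
      a `^ q * b `^ q + W * (a `^ q + b `^ q) <=
      d i `^ q * d j `^ q + W * (d i `^ q + d j `^ q).
    move=> a0 b0 ab.
    pose d' l := if l == i then a else if l == j then b else d l.
    have d'0 l : 0 <= d' l by rewrite /d'; case: ifP => //; case: ifP.
    have d'1 : \sum_l d' l = 1.
      have s (v : 'I_n -> R) : \sum_l v l =
          v i + (v j + \sum_(l | (l != i) && (l != j)) v l).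
        by rewrite (bigD1 i)//= (bigD1 j).
      rewrite s (@replace_pair_sum R n id d i j)// {1 2}/d' !eqxx (negbTE ji).
      by rewrite addrA ab -addrA -s.
    have := cmax d' d'0 d'1; rewrite !Fpow//.
    rewrite !(sqr_sum_sub_pair _ _ _ i j)//.
    rewrite (@replace_pair_sum R n (fun y => y `^ q) d i j)//.
    rewrite (@replace_pair_sum R n (fun y => (y `^ q) ^+ 2) d i j)//.
    rewrite -/W /d' !eqxx (negbTE ji).
    by rewrite lerD2l ler_pM2l.
  have [H|H] := pair_improvable _ _ _ _ W q1 di dj dij W0.
    have := repl ((d i + d j) / 2) ((d i + d j) / 2).
    by move=> /(_ ltac:(lra) ltac:(lra) ltac:(lra)); rewrite leNgt H.
  have := repl (d i + d j) 0.
  move=> /(_ ltac:(lra) ltac:(lra) ltac:(lra)).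
  by rewrite (powR0 (_ : q != 0)) ?gt_eqF//; [rewrite mulr0 add0r addr0 leNgt H|lra].
pose S := [set i | 0 < d i]%SET.
have dS i : i \notin S -> d i = 0.
  by rewrite inE -leNgt => h; apply/eqP; rewrite eq_le h d0.
have sumS (f : R -> R) : f 0 = 0 -> \sum_i f (d i) = \sum_(i in S) f (d i).
  by move=> f0; rewrite [RHS]big_mkcond; apply: eq_bigr => i _; case: ifPn => // /dS ->.
have [i0 i0S] : exists i0, i0 \in S.
  apply/set0Pn; apply: contra_eq_neq c1 => S0.
  by rewrite (sumS id)// S0 big_set0 eq_sym oner_eq0.
have dE i : i \in S -> d i = #|S|%:R^-1.
  have S0 : (#|S|%:R : R) != 0.
    by rewrite pnatr_eq0 -lt0n; apply/card_gt0P; exists i0.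
  move=> iS; apply: (mulfI S0); rewrite divff// -[RHS]c1 (sumS id)//=.
  rewrite mulr_natl -sumr_const; apply: eq_bigr => j jS.
  by apply: eqd; [rewrite inE in iS|rewrite inE in jS].
(* A nonzero exponent makes 0^q = 0, so the coordinates outside [S] drop out of both sums. *)
have q0 : q != 0 by rewrite gt_eqF//; lra.
rewrite (sumS (fun y => y `^ q)) ?powR0//.
rewrite (sumS (fun y => (y `^ q) ^+ 2)) ?powR0 ?expr0n//.
have -> : \sum_(i in S) d i `^ q = #|S|%:R * #|S|%:R^-1 `^ q.
  by rewrite mulr_natl -sumr_const; apply: eq_bigr => i /dE ->.
have -> : \sum_(i in S) (d i `^ q) ^+ 2 = #|S|%:R * (#|S|%:R^-1 `^ q) ^+ 2.
  by rewrite mulr_natl -sumr_const; apply: eq_bigr => i /dE ->.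
have := HT #|S|; rewrite card_gt0; move=> /(_ ltac:(by apply/set0Pn; exists i0)).
by apply: le_trans; rewrite le_eqVlt; apply/orP; left; apply/eqP; ring.
Qed.

(** * The optimal number of coordinates *)

(** Concavity of ln (x - 1) in the variable ln x, with slope y/(y-1) at y. It is Bernoulli's
    inequality at x/y with exponent y/(y-1), whose linear side is exactly (x-1)/(y-1). *)
Lemma ln_pred_tangent (R : realType) (x y : R) : 1 < x -> 1 < y ->
  ln (x - 1) - ln (y - 1) <= y / (y - 1) * (ln x - ln y).
Proof.
move=> x1 y1.
have y0 : 0 < y by lra.
have x0 : 0 < x by lra.
have y10 : 0 < y - 1 by lra.
have x10 : 0 < x - 1 by lra.
have q1 : 1 < y / (y - 1) by rewrite ltr_pdivlMr//; lra.
have s0 : 0 < x / y by rewrite divr_gt0.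
have B : (x - 1) / (y - 1) <= (x / y) `^ (y / (y - 1)).
  have [s1|s1] := eqVneq (x / y) 1.
    have xy : x = y by rewrite -(divfK (lt0r_neq0 y0) x) s1 mul1r.
    by rewrite s1 powR1 xy divff ?gt_eqF.
  apply: le_trans (ltW (bernoulli_powR _ _ _ q1 s0 s1)).
  rewrite le_eqVlt; apply/orP; left; apply/eqP; field.
  by rewrite !gt_eqF.
rewrite -!ln_div ?posrE// -ln_powR ler_ln ?posrE ?divr_gt0// powR_gt0//.
Qed.

Definition ln_tau (R : realType) (p x : R) : R := (1 - 2 / p) * ln x + ln (x - 1).

Lemma ln_tau_tangent (R : realType) (p x y : R) : 1 < x -> 1 < y ->
  ln_tau R p x <= ln_tau R p y + (y / (y - 1) + (1 - 2 / p)) * (ln x - ln y).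
Proof. by move=> x1 y1; have := ln_pred_tangent _ x y x1 y1; rewrite /ln_tau; lra. Qed.

(** This explains the thresholds: [pk j] is the value of p at which j and j + 1 coordinates tie, and
    the last factor is positive. *)
Lemma ln_tauS_sub (R : realType) (p : R) (j : nat) : 0 < p -> (2 <= j)%N ->
  p * (ln_tau R p j.+1%:R - ln_tau R p j%:R) =
  (p - pk j) * (ln (j.+1%:R : R) - ln (j%:R - 1)).
Proof.
move=> p0 j2; have j2R : (2 : R) <= j%:R by rewrite (ler_nat R 2).
rewrite /pk leqNgt j2/= /ln_tau -(natr1 j).
have -> : 1 + 1 / j%:R = (j%:R + 1) / j%:R :> R by field; rewrite gt_eqF//; lra.
have -> : 1 + 2 / (j%:R - 1) = (j%:R + 1) / (j%:R - 1) :> R.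
  by field; rewrite gt_eqF//; lra.
rewrite !ln_div ?posrE; try lra.
have D0 : 0 < ln (j%:R + 1) - ln (j%:R - 1) :> R.
  by rewrite subr_gt0 ltr_ln ?posrE; lra.
rewrite addrK; field.
by rewrite !gt_eqF.
Qed.

(* [ln_tau] is concave as a function of [ln x], so it is unimodal and
   comparing neighbours of [k] suffices. *)
Lemma ln_tau_le (R : realType) (p : R) (k m : nat) : 0 < p -> (2 <= k)%N ->
  pk k.-1 < p <= pk k -> (2 <= m)%N -> ln_tau R p m%:R <= ln_tau R p k%:R.
Proof.
move=> p0 k2 /andP[pk1 pk2] m2.
have k2R : (2 : R) <= k%:R by rewrite (ler_nat R 2).
have m2R : (2 : R) <= m%:R by rewrite (ler_nat R 2).
have D j : (2 <= j)%N -> 0 < ln (j.+1%:R : R) - ln (j%:R - 1).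
  move=> j2; have j2R : (2 : R) <= j%:R by rewrite (ler_nat R 2).
  by rewrite subr_gt0 ltr_ln ?posrE -?natr1; lra.
case: (ltngtP m k) => [mk|km|->]; last by [].
- have [k' kE] : exists k', k = k'.+1 by exists k.-1; rewrite prednK// (ltn_trans _ k2).
  (* Since 2 <= m < k, the index k - 1 is at least 2, so [pk k.-1] is given by the logarithmic
     formula and not by the convention for k = 1. *)
  have k'2 : (2 <= k')%N by rewrite -ltnS -kE (leq_ltn_trans m2).
  have k'2R : (2 : R) <= k'%:R by rewrite (ler_nat R 2).
  have mk' : (m%:R : R) <= k'%:R by rewrite ler_nat -ltnS -kE.
  (* As k beats k - 1, the tangent at k - 1 has positive slope, and every smaller m lies below
     it. *)
  have up : ln_tau R p k'%:R < ln_tau R p k%:R.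
    rewrite -subr_gt0 -(pmulr_rgt0 _ p0) kE ln_tauS_sub//.
    by rewrite mulr_gt0 ?D// subr_gt0; rewrite kE in pk1.
  have t1 := ln_tau_tangent _ p k%:R k'%:R ltac:(lra) ltac:(lra).
  have t2 := ln_tau_tangent _ p m%:R k'%:R ltac:(lra) ltac:(lra).
  apply: (le_trans _ (ltW up)); apply: (le_trans t2).
  have l1 : 0 < ln (k%:R : R) - ln k'%:R.
    have kR : (k%:R : R) = k'%:R + 1 by rewrite kE natr1.
    by rewrite subr_gt0 ltr_ln ?posrE; lra.
  have l2 : ln (m%:R : R) - ln k'%:R <= 0.
    by rewrite subr_le0 ler_ln ?posrE; lra.
  move: t1; set c := _ + (1 - 2 / p) => t1.
  have c0 : 0 < c by rewrite -(pmulr_lgt0 _ l1); lra.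
  have : c * (ln m%:R - ln k'%:R) <= 0 by rewrite pmulr_rle0.
  by lra.
(* Symmetrically, the tangent at k + 1 has nonpositive slope, which handles every m > k. *)
have down : ln_tau R p k.+1%:R <= ln_tau R p k%:R.
  rewrite -subr_le0 -(pmulr_rle0 _ p0) ln_tauS_sub// pmulr_lle0 ?D//.
  by rewrite subr_le0.
have km' : (k.+1%:R : R) <= m%:R by rewrite ler_nat.
have kS : (k.+1%:R : R) = k%:R + 1 by rewrite natr1.
have t1 := ln_tau_tangent _ p k%:R k.+1%:R ltac:(lra) ltac:(lra).
have t2 := ln_tau_tangent _ p m%:R k.+1%:R ltac:(lra) ltac:(lra).
apply: (le_trans _ down); apply: (le_trans t2).
have l1 : ln (k%:R : R) - ln k.+1%:R < 0.
  by rewrite subr_lt0 ltr_ln ?posrE; lra.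
have l2 : 0 <= ln (m%:R : R) - ln k.+1%:R.
  by rewrite subr_ge0 ler_ln ?posrE; lra.
move: t1; set c := _ + (1 - 2 / p) => t1.
have c0 : c <= 0 by rewrite -(nmulr_lge0 _ l1); lra.
have : c * (ln m%:R - ln k.+1%:R) <= 0 by rewrite mulr_le0_ge0.
by lra.
Qed.

Lemma tau_k_gt0 (R : realType) (p : R) (m : nat) : (2 <= m)%N -> 0 < tau_k m p.
Proof.
move=> m2; have m2R : (2 : R) <= m%:R by rewrite (ler_nat R 2).
by rewrite /tau_k mulr_gt0 ?powR_gt0; lra.
Qed.

Lemma ln_tau_k (R : realType) (p : R) (m : nat) : (2 <= m)%N ->
  ln (tau_k m p) = ln_tau R p m%:R.
Proof.
move=> m2; have m2R : (2 : R) <= m%:R by rewrite (ler_nat R 2).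
by rewrite /tau_k lnM ?posrE ?powR_gt0 ?ln_powR//; lra.
Qed.

Lemma tau_k_le (R : realType) (p : R) (k m : nat) : 0 < p -> (2 <= k)%N ->
  pk k.-1 < p <= pk k -> (0 < m)%N -> tau_k m p <= tau_k k p.
Proof.
move=> p0 k2 pkk; rewrite leq_eqVlt => /predU1P[<-|m2].
  (* One coordinate gives the value 0; it is set apart because [ln_tau] is compared only for m >=
     2. *)
  by rewrite /tau_k subrr mulr0 ltW//; exact: tau_k_gt0.
by rewrite -ler_ln ?posrE ?tau_k_gt0// !ln_tau_k// ln_tau_le.
Qed.

(** * From the simplex to the sphere: the upper bound on H_n *)

Lemma sum_ltn_pairs (R : realType) (n : nat) (a : nat -> R) :
  2 * (\sum_(i < n) \sum_(j < n | (i < j)%N) a i * a j) =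
  (\sum_(i < n) a i) ^+ 2 - \sum_(i < n) a i ^+ 2.
Proof.
pose S := \sum_(i < n) \sum_(j < n | (i < j)%N) a i * a j.
have S' : \sum_(i < n) \sum_(j < n | (j < i)%N) a i * a j = S.
  rewrite (exchange_big_dep xpredT)//=; apply: eq_bigr => i _.
  by apply: eq_bigr => j _; rewrite mulrC.
have -> : (\sum_(i < n) a i) ^+ 2 =
    \sum_(i < n) (\sum_(j < n | (i < j)%N) a i * a j +
    (\sum_(j < n | (j < i)%N) a i * a j + a i ^+ 2)).
  rewrite expr2 mulr_suml; apply: eq_bigr => i _; rewrite mulr_sumr.
  rewrite (bigID (fun j : 'I_n => (i < j)%N))/=; congr (_ + _).
  rewrite (bigD1 i) ?ltnn//= addrC -expr2; congr (_ + _).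
  by apply: eq_bigl => j; rewrite -leqNgt andbC -ltn_neqAle.
by rewrite !big_split/= S' -/S; ring.
Qed.

(** Both sides are homogeneous of degree 2. After passing to |s_i|, the point x_i = |s_i|^p / N lies
    on the simplex and [simplex_pair_max] applies with q = 1/p. *)
Lemma pairs_le_tau (R : realType) (p : R) (k n : nat) (s : nat -> R) :
  0 < p < 1 -> (2 <= k)%N -> pk k.-1 < p <= pk k ->
  \sum_(i < n) \sum_(j < n | (i < j)%N) s i * s j <=
  tau_k k p / 2 * (\sum_(i < n) `|s i| `^ p) `^ (2 / p).
Proof.
move=> /andP[p0 p1] k2 pkk.
have pn0 : p != 0 by rewrite gt_eqF.
have q1 : 1 < p^-1 by rewrite invf_gt1.
set N := \sum_(i < n) `|s i| `^ p.
have N0 : 0 <= N by apply: sumr_ge0 => i _; exact: powR_ge0.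
apply: (@le_trans _ _ (\sum_(i < n) \sum_(j < n | (i < j)%N) `|s i| * `|s j|)).
  by apply: ler_sum => i _; apply: ler_sum => j _; rewrite -normrM ler_norm.
rewrite -(@ler_pM2l _ 2)// (sum_ltn_pairs _ n (fun i => `|s i|)).
have -> : 2 * (tau_k k p / 2 * N `^ (2 / p)) = tau_k k p * N `^ (2 / p) by field.
have [N00|Nn] := eqVneq N 0.
  have si (i : 'I_n) : `|s i| = 0.
    apply: (@powR_eq0_eq0 _ _ p); move/eqP: N00.
    rewrite psumr_eq0; last by move=> j _; exact: powR_ge0.
    by move=> /allP/(_ i (mem_index_enum i))/implyP/(_ isT)/eqP.
  have e1 : \sum_(i < n) `|s i| = 0 by apply: big1 => i _; exact: si.
  have e2 : \sum_(i < n) `|s i| ^+ 2 = 0 by apply: big1 => i _; rewrite si expr0n.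
  rewrite e1 e2 expr0n subr0.
  by rewrite mulr_ge0 ?powR_ge0// ltW// tau_k_gt0.
have {Nn N0} N0 : 0 < N by rewrite lt_neqAle eq_sym Nn.
pose x (i : 'I_n) := `|s i| `^ p / N.
have x0 i : 0 <= x i by rewrite divr_ge0 ?powR_ge0 ?ltW.
have x1 : \sum_i x i = 1 by rewrite -mulr_suml divff// gt_eqF.
have sE (i : 'I_n) : `|s i| = N `^ p^-1 * x i `^ p^-1.
  rewrite -powRM ?x0 ?(ltW N0)// mulrC divfK ?gt_eqF//.
  by rewrite -powRrM mulfV// powRr1.
have NE : N `^ (2 / p) = (N `^ p^-1) ^+ 2.
  have -> : 2 / p = p^-1 + p^-1 by ring.
  by rewrite powRD ?expr2// (gt_eqF N0) implybT.
have T m : (0 < m)%N -> m%:R * (m%:R - 1) * (m%:R^-1 `^ p^-1) ^+ 2 <= tau_k k p.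
  move=> m0; apply: le_trans (tau_k_le _ p k m p0 k2 pkk m0).
  have m0R : (0 : R) < m%:R by rewrite ltr0n.
  have mD (a b : R) : m%:R `^ (a + b) = m%:R `^ a * m%:R `^ b :> R.
    by rewrite powRD// (gt_eqF m0R) implybT.
  rewrite /tau_k (_ : 1 - 2 / p = 1 + (-1 * p^-1 + -1 * p^-1)); last by ring.
  rewrite -powR_inv1 ?(ltW m0R)// -powRrM !mD powRr1 ?(ltW m0R)// expr2.
  by rewrite mulrAC.
have H := simplex_pair_max _ n _ _ q1 T x x0 x1.
apply: le_trans (ler_wpM2r (powR_ge0 N (2 / p)) H); rewrite NE.
under eq_bigr do rewrite sE; under [X in _ - X]eq_bigr do rewrite sE exprMn.
by rewrite -!mulr_sumr exprMn; rewrite le_eqVlt; apply/orP; left; apply/eqP; ring.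
Qed.

Lemma Hn_normalized_le (R : realType) (p : R) (k n : nat) (x : nat -> R) :
  0 < p < 1 -> (2 <= k)%N -> pk k.-1 < p <= pk k -> (0 < n)%N ->
  Hn n (fun i => x i / lpnorm n p x) <= tau_k k p / 2 * n%:R `^ (2 / p - 1).
Proof.
move=> p01 k2 pkk n0; have /andP[p0 p1] := p01.
have pn0 : p != 0 by rewrite gt_eqF.
have n0R : (0 : R) < n%:R by rewrite ltr0n.
rewrite /Hn powRB ?(gt_eqF n0R) ?implybT// powRr1 ?(ltW n0R)// mulrA ler_pM2r ?invr_gt0//.
apply: (le_trans (pairs_le_tau _ p k n (fun i => x i / lpnorm n p x) p01 k2 pkk)).
rewrite ler_pM2l ?divr_gt0 ?tau_k_gt0//.
apply: ge0_ler_powR; rewrite ?nnegrE ?(ltW n0R)//.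
- by rewrite divr_ge0// ltW.
- by apply: sumr_ge0 => i _; exact: powR_ge0.
set A := \sum_(i < n) `|x i| `^ p.
have A0 : 0 <= A by apply: sumr_ge0 => i _; exact: powR_ge0.
have LE : `|lpnorm n p x| `^ p = A / n%:R.
  by rewrite ger0_norm ?powR_ge0// /lpnorm -powRrM divfK// powRr1// divr_ge0 // ltW.
under eq_bigr do rewrite normrM powRM// normfV -powR_inv1// -powRrM mulN1r powRN LE.
rewrite -mulr_suml -/A invf_div.
(* If all coordinates of x vanish, the normalized sum is 0; otherwise it is exactly n. *)
have [->|An] := eqVneq A 0; first by rewrite mul0r ltW.
by rewrite mulrC divfK.
Qed.

(** * Iterated integrals and the density *)

Section IteratedIntegral.
Variable R : realType.
Notation mu := (@lebesgue_measure R).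
Local Open Scope ereal_scope.

(* No measurability is needed: the integral of a nonnegative function is a
   supremum over the simple functions below it. *)
Lemma le_integral_ge0 (f g : R -> \bar R) :
  (forall x, 0 <= f x) -> (forall x, f x <= g x) ->
  \int[mu]_x f x <= \int[mu]_x g x.
Proof.
move=> f0 fg; rewrite !ge0_integralTE//; last by move=> x; exact: le_trans (fg x).
apply: le_ereal_sup => _ [h /= hf <-]; exists h => //= x.
exact: le_trans (hf x) (fg x).
Qed.

Lemma iter_int_ge0 (k : nat) (F : (nat -> R) -> \bar R) :
  (forall x, 0 <= F x) -> 0 <= iter_int k F.
Proof.
elim: k F => [|k IH] F F0 /=; first exact: F0.
by apply: integral_ge0 => t _; apply: IH => x; exact: F0.
Qed.

Lemma le_iter_int (k : nat) (F G : (nat -> R) -> \bar R) :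
  (forall x, 0 <= F x) -> (forall x, F x <= G x) ->
  iter_int k F <= iter_int k G.
Proof.
elim: k F G => [|k IH] F G F0 FG /=; first exact: FG.
apply: le_integral_ge0 => t; first by apply: iter_int_ge0 => x; exact: F0.
by apply: IH => x; [exact: F0|exact: FG].
Qed.

(** The constant [C] carries the induction: the factor of the outermost variable is constant for the
    inner integrals and is absorbed into it. *)
Lemma iter_int_prod (k : nat) (g : nat -> R -> R) (a : nat -> R) (C : R) :
  (forall i, measurable_fun setT (g i)) -> (forall i x, (0 <= g i x)%R) ->
  (forall i, \int[mu]_x (g i x)%:E = (a i)%:E) -> (0 <= C)%R ->
  iter_int k (fun x => (C * \prod_(i < k) g i (x i))%:E) =
  (C * \prod_(i < k) a i)%:E.
Proof.
move=> mg g0 ga; have a0 i : (0 <= a i)%R.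
  by rewrite -lee_fin -ga; apply: integral_ge0 => x _; rewrite lee_fin.
elim: k C => [|k IH] C C0 /=; first by rewrite !big_ord0.
transitivity (\int[mu]_t ((C * \prod_(i < k) a i)%:E * (g k t)%:E)).
  apply: eq_integral => t _.
  transitivity (iter_int k (fun x => (C * g k t * \prod_(i < k) g i (x i))%:E)).
    congr iter_int; apply/funext => x; rewrite big_ord_recr/= eqxx.
    congr (_%:E); rewrite -mulrA; congr (_ * _)%R; rewrite mulrC; congr (_ * _)%R.
    by apply: eq_bigr => i _; rewrite ltn_eqF.
  by rewrite IH ?mulr_ge0// -EFinM mulrAC.
rewrite ge0_integralZl_EFin//.
- by rewrite ga -EFinM big_ord_recr/= mulrA.
- by move=> x _; rewrite lee_fin.
- by apply/measurable_EFinP; exact: mg.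
- by apply: mulr_ge0 => //; apply: prodr_ge0 => i _.
Qed.

Lemma integral_indic_itv (c m : R) :
  \int[mu]_x (m * \1_(`[c, c + 1]%classic) x)%:E = m%:E.
Proof.
transitivity (\int[mu]_(x in `[c, (c + 1)%R]%classic) cst m%:E x).
  rewrite [RHS]integral_mkcond; apply: eq_integral => x _.
  rewrite patchE indicE; case: (x \in _); first by rewrite mulr1.
  by rewrite mulr0.
rewrite integral_cst//= lebesgue_measure_itv/= lte_fin ltrDl ltr01.
by rewrite -EFinD addrAC subrr add0r mule1.
Qed.

Lemma integral_oneDsqrV_lty : \int[mu]_x ((oneDsqr x)^-1)%:E < +oo.
Proof.
rewrite ge0_symfun_integralT.
- rewrite (_ : [set x | _] = `[0%R, +oo[%classic); last first.
    by apply/seteqP; split => x /=; rewrite in_itv/= andbT.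
  by rewrite integral0y_oneDsqr -EFinM ltry.
- by move=> x; rewrite invr_ge0 (le_trans ler01)// oneDsqr_ge1.
- exact: continuous_oneDsqrV.
- by move=> x /=; rewrite /oneDsqr sqrrN.
Qed.

(** Comparison with C / (1 + x^2); it yields the finiteness of both the Gamma integral and the mass
    of [rho]. *)
Lemma integral_lty_oneDsqr (f : R -> R) (C : R) :
  (forall x, (0 <= f x)%R) -> (0 <= C)%R ->
  (forall x, (f x * oneDsqr x <= C)%R) -> \int[mu]_x (f x)%:E < +oo.
Proof.
move=> f0 C0 fC.
have pos x : (0 < oneDsqr x :> R)%R by rewrite (lt_le_trans ltr01)// oneDsqr_ge1.
apply: (@le_lt_trans _ _ (\int[mu]_x (C%:E * ((oneDsqr x)^-1)%:E))).
  apply: le_integral_ge0 => x; first by rewrite lee_fin.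
  by rewrite -EFinM lee_fin ler_pdivlMr.
rewrite ge0_integralZl_EFin//.
- by apply: lte_mul_pinfty; rewrite ?lee_fin ?integral_oneDsqrV_lty.
- apply/measurable_EFinP; apply: continuous_measurable_fun.
  exact: continuous_oneDsqrV.
Qed.

End IteratedIntegral.

(** Raise y/s <= e^(y/s) to the power s. *)
Lemma powR_le_expR (R : realType) (s y : R) : 0 < s -> 0 <= y ->
  y `^ s <= s `^ s * expR y.
Proof.
move=> s0 y0; have ys0 : 0 <= y / s by rewrite divr_ge0// ltW.
rewrite -{1}(divfK (lt0r_neq0 s0) y) powRM ?(ltW s0)// mulrC ler_pM2l ?powR_gt0//.
rewrite -{2}(divfK (lt0r_neq0 s0) y) expRM.
apply: ge0_ler_powR; rewrite ?nnegrE ?(ltW s0) ?expR_ge0//.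
by apply: le_trans (expR_ge1Dx _); rewrite lerDr.
Qed.

Section Density.
Variable R : realType.
Notation mu := (@lebesgue_measure R).

(** Since [fine] sends an infinite value to 0, positivity requires the integral to be finite as well
    as bounded below by a positive number. *)
Lemma Gamma_gt0 (s : R) : 1 < s -> 0 < Gamma s.
Proof.
move=> s1; pose f (t : R) := t `^ (s - 1) * expR (- t).
have f0 t : 0 <= f t by rewrite mulr_ge0 ?powR_ge0 ?expR_ge0.
pose g := (fun t : R => (f t)%:E) \_ `]0, +oo[%classic.
have gE : (\int[mu]_(t in `]0%R, +oo[) (f t)%:E = \int[mu]_t g t)%E.
  by rewrite integral_mkcond.
have gf t : g t = (f t * \1_(`]0, +oo[%classic) t)%:E.
  by rewrite /g patchE indicE; case: (t \in _); rewrite ?mulr1 ?mulr0.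
have gy : (\int[mu]_t g t < +oo)%E.
  under eq_integral do rewrite gf.
  (* Multiplying by 1 + t^2 leaves the powers s - 1 and s + 1 of t, each bounded by
     [powR_le_expR]. *)
  apply: (@integral_lty_oneDsqr _ _
    ((s - 1) `^ (s - 1) + (s + 1) `^ (s + 1))).
  - by move=> t; rewrite mulr_ge0.
  - by rewrite addr_ge0 ?powR_ge0.
  move=> t; rewrite indicE.
  have [t0|t0] := ltP 0 t; last first.
    rewrite memNset ?mulr0 ?mul0r ?addr_ge0 ?powR_ge0//=.
    by rewrite in_itv/= andbT ltNge t0.
  rewrite mem_set/=; last by rewrite in_itv/= andbT.
  rewrite mulr1 /f /oneDsqr.
  have -> : t `^ (s - 1) * expR (- t) * (1 + t ^+ 2) =
      (t `^ (s - 1) + t `^ (s + 1)) * expR (- t).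
    have -> : t `^ (s + 1) = t `^ (s - 1) * t ^+ 2.
      rewrite -powR_mulrn ?(ltW t0)// -powRD; first by congr (_ `^ _); ring.
      by apply/implyP => /eqP; lra.
    ring.
  rewrite expRN ler_pdivrMr ?expR_gt0// mulrDl lerD// powR_le_expR ?(ltW t0)//; lra.
(* On [1, 2] the power is at least 1 and the exponential at least e^(-2). *)
have glow : ((expR (- 2))%:E <= \int[mu]_t g t)%E.
  rewrite -(integral_indic_itv _ 1); apply: le_integral_ge0 => t.
    by rewrite lee_fin mulr_ge0 ?expR_ge0.
  rewrite gf lee_fin !indicE.
  have [tI|tI] := boolP (t \in `[1, 1 + 1]%classic); last first.
    by rewrite mulr0 mulr_ge0.
  move: tI; rewrite inE/= in_itv/= => /andP[t1 t2].
  rewrite mem_set/=; last by rewrite in_itv/= andbT; lra.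
  rewrite !mulr1.
  rewrite -[leLHS]mul1r ler_pM ?expR_ge0//; last by rewrite ler_expR; lra.
  by rewrite -{1}(powRr0 t) ler_powR//; lra.
rewrite (_ : Gamma s = fine (\int[mu]_t g t)%E); last by rewrite /Gamma -gE.
rewrite -lte_fin fineK; last first.
  by rewrite ge0_fin_numE// (le_trans _ glow)// lee_fin expR_ge0.
by apply: lt_le_trans glow; rewrite lte_fin expR_gt0.
Qed.

Lemma c_p_gt0 (p : R) : 0 < p -> 0 < c_p p.
Proof.
move=> p0; rewrite /c_p divr_gt0 ?powR_gt0// mulr_gt0// Gamma_gt0//.
by rewrite ltrDl divr_gt0.
Qed.

Lemma rho_ge0 (p x : R) : 0 < p -> 0 <= rho p x.
Proof. by move=> p0; rewrite /rho mulr_ge0 ?expR_ge0// ltW// c_p_gt0. Qed.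

Lemma measurable_rho (p : R) : measurable_fun setT (rho p).
Proof.
apply: measurable_funM; first exact: measurable_cst.
apply: measurableT_comp => //; apply: measurable_funM; last exact: measurable_cst.
apply: measurableT_comp; first exact: oppr_measurable.
by apply: (measurableT_comp (measurable_powR _)); exact: normr_measurable.
Qed.

Lemma integral_rho_lty (p : R) : 0 < p -> (\int[mu]_x (rho p x)%:E < +oo)%E.
Proof.
move=> p0; have pn0 : p != 0 by rewrite gt_eqF.
(* With y = |x|^p / p one has x^2 = p^(2/p) y^(2/p), and [powR_le_expR] at exponent 2/p gives x^2 <=
   K e^y. *)
pose K := p `^ (2 / p) * (2 / p) `^ (2 / p).
have K0 : 0 <= K by rewrite mulr_ge0 ?powR_ge0.
apply: (@integral_lty_oneDsqr _ _ (c_p p * (1 + K))).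
- by move=> x; exact: rho_ge0.
- by rewrite mulr_ge0 ?addr_ge0// ltW// c_p_gt0.
move=> x; rewrite /rho /oneDsqr -mulrA ler_pM2l ?c_p_gt0//.
set y := `|x| `^ p / p.
have y0 : 0 <= y by rewrite divr_ge0 ?powR_ge0 ?ltW.
rewrite mulNr -/y expRN mulrC ler_pdivrMr ?expR_gt0// mulrDl mul1r lerD//.
  by apply: le_trans (expR_ge1Dx _); rewrite lerDl.
have -> : x ^+ 2 = p `^ (2 / p) * y `^ (2 / p).
  rewrite -powRM ?(ltW p0)// mulrC /y divfK// -powRrM mulrCA divff// mulr1.
  by rewrite powR_mulrn// real_normK// num_real.
by rewrite /K -mulrA ler_wpM2l ?powR_ge0// powR_le_expR// divr_gt0.
Qed.

End Density.

(** * Bounds on the partition function *)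

Lemma sum_pairs_ge (R : realType) (k n : nat) (u : R) (s : nat -> R) :
  (k <= n)%N -> 0 <= u -> (forall i, (i < n)%N -> 0 <= s i) ->
  (forall i, (i < k)%N -> u <= s i) ->
  k%:R * (k%:R - 1) / 2 * u ^+ 2 <= \sum_(i < n) \sum_(j < n | (i < j)%N) s i * s j.
Proof.
move=> kn u0 s0 us.
pose a i : R := if (i < k)%N then u else 0.
have as_ (i : 'I_n) : 0 <= a i <= s i.
  by rewrite /a; case: ifP => ik; rewrite ?u0 ?us ?lexx ?s0.
apply: (@le_trans _ _ (\sum_(i < n) \sum_(j < n | (i < j)%N) a i * a j)); last first.
  apply: ler_sum => i _; apply: ler_sum => j _.
  by have /andP[? ?] := as_ i; have /andP[? ?] := as_ j; exact: ler_pM.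
rewrite -(@ler_pM2l _ 2)// sum_ltn_pairs.
have sumk (c : R) : \sum_(i < n) (if (i < k)%N then c else 0) = k%:R * c.
  rewrite -big_mkcond/= -(big_ord_widen n (fun=> c))// sumr_const card_ord.
  by rewrite mulr_natl.
have -> : \sum_(i < n) a i = k%:R * u by exact: sumk.
have -> : \sum_(i < n) a i ^+ 2 = k%:R * u ^+ 2.
  rewrite -sumk; apply: eq_bigr => i _.
  by rewrite /a; case: ifP => // _; rewrite expr0n.
by rewrite le_eqVlt; apply/orP; left; apply/eqP; field.
Qed.

Section Asymptotics.
Variables (R : realType) (p beta : R).
Hypotheses (p0 : 0 < p) (p1 : p < 1) (beta0 : 0 < beta).
Let pn0 : p != 0. Proof. by rewrite gt_eqF. Qed.

Let integrand (n : nat) (x : nat -> R) : R :=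
  expR (beta * Hn n (fun i => x i / lpnorm n p x)) * \prod_(i < n) rho p (x i).

Let integrand_ge0 n x : (0 <= (integrand n x)%:E)%E.
Proof.
by rewrite lee_fin mulr_ge0 ?expR_ge0// prodr_ge0// => i _; exact: rho_ge0.
Qed.

Lemma Znp_le (k n : nat) : (2 <= k)%N -> pk k.-1 < p <= pk k -> (0 < n)%N ->
  (Znp n p beta <= (expR (beta / 2 * tau_k k p * n%:R `^ (2 / p - 1)
     + n%:R * fine (\int[@lebesgue_measure R]_x (rho p x)%:E)))%:E)%E.
Proof.
move=> k2 pkk n0; set I := fine _.
set M := expR (beta / 2 * tau_k k p * n%:R `^ (2 / p - 1)).
have rI : (\int[@lebesgue_measure R]_x (rho p x)%:E = I%:E)%E.
  rewrite /I fineK// ge0_fin_numE ?integral_rho_lty//.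
  by apply: integral_ge0 => x _; rewrite lee_fin rho_ge0.
have I0 : 0 <= I.
  by apply: fine_ge0; apply: integral_ge0 => x _; rewrite lee_fin rho_ge0.
apply: (@le_trans _ _ (iter_int n (fun x => (M * \prod_(i < n) rho p (x i))%:E))).
  apply: le_iter_int => x; first exact: integrand_ge0.
  rewrite lee_fin ler_wpM2r ?prodr_ge0//; first by move=> i _; exact: rho_ge0.
  rewrite ler_expR (_ : beta / 2 * _ * _ =
    beta * (tau_k k p / 2 * n%:R `^ (2 / p - 1))); last by field.
  by rewrite ler_pM2l// Hn_normalized_le// p0 p1.
rewrite (@iter_int_prod _ n (fun=> rho p) (fun=> I)) ?expR_ge0//; last 2 first.
- by move=> _; exact: measurable_rho.
- by move=> _ x; exact: rho_ge0.
rewrite lee_fin expRD ler_pM2l ?expR_gt0// prodr_const card_ord.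
(* I^n <= e^(nI), from I <= 1 + I <= e^I. *)
rewrite mulrC expRM_natr lerXn2r ?nnegrE ?expR_ge0//.
by apply: le_trans (expR_ge1Dx _); rewrite lerDr.
Qed.

(* The box on which [k] coordinates are of order [T = n^(1/p^2)]; then
   [T^p = n^(1/p)] dominates the contribution [n] of the other coordinates. *)
Let T (n : nat) : R := n%:R `^ p^-1 `^ p^-1.
Let box (k n i : nat) : set R :=
  `[(if (i < k)%N then T n else 0), (if (i < k)%N then T n else 0) + 1]%classic.

Let Tp n : T n `^ p = n%:R `^ p^-1.
Proof. by rewrite /T -powRrM mulVf// powRr1// powR_ge0. Qed.

Let T_ge1 n : (0 < n)%N -> 1 <= T n.
Proof.
move=> n0; have n1 : (1 : R) <= n%:R by rewrite ler1n.
have pV : 1 <= p^-1 by rewrite invf_ge1// ltW.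
have a1 := le1r_powR n1 pV.
exact: le_trans (le_trans n1 a1) (le1r_powR (le_trans n1 a1) pV).
Qed.

(** For the large coordinates, (T + 1)^p = T^p (1 + 1/T)^p <= T^p + T^(p-1) <= T^p + 1, as T >= 1
    and p < 1. *)
Let box_powR_le k n i x : (0 < n)%N -> box k n i x ->
  0 <= x /\ `|x| `^ p <= (if (i < k)%N then n%:R `^ p^-1 else 0) + 1.
Proof.
move=> n0; have T1 := T_ge1 n n0; rewrite /box /= in_itv/= => /andP[lx xu].
have x0 : 0 <= x by apply: le_trans lx; case: ifP => // _; lra.
split=> //; rewrite ger0_norm//.
have : x `^ p <= ((if (i < k)%N then T n else 0) + 1) `^ p.
  apply: ge0_ler_powR; rewrite ?nnegrE ?(ltW p0)//.
  by apply: le_trans xu.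
move/le_trans; apply; case: ifP => _; last by rewrite add0r powR1.
rewrite -Tp (_ : T n + 1 = T n * (1 + (T n)^-1)); last first.
  by field; rewrite gt_eqF//; lra.
have V0 : 0 < (T n)^-1 by rewrite invr_gt0; lra.
rewrite powRM; [|lra|lra].
have t1 : (1 + (T n)^-1) `^ p <= 1 + (T n)^-1 by rewrite ler1_powR//; [lra|exact: ltW].
have tp : T n `^ p * (T n)^-1 <= 1.
  by rewrite ler_pdivrMr ?mul1r; [rewrite ler1_powR// ltW|lra].
have := ler_wpM2l (powR_ge0 (T n) p) t1.
by rewrite mulrDr mulr1; lra.
Qed.

(** On the box the sum of the |x_i|^p is at most n^(1/p) D, where D = k + 2 n^(1-1/p) tends to k.
    Hence each of the k large coordinates, once normalized, is at least (n/D)^(1/p), and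
    [sum_pairs_ge] applies. *)
Lemma Hn_ge_box (k n : nat) (x : nat -> R) : (0 < k)%N -> (k <= n)%N ->
  (forall i, (i < n)%N -> box k n i (x i)) ->
  k%:R * (k%:R - 1) / 2 * (k%:R + 2 * n%:R `^ (1 - p^-1)) `^ (- (2 / p))
    * n%:R `^ (2 / p - 1) <= Hn n (fun i => x i / lpnorm n p x).
Proof.
move=> k0 kn xbox; have n0 : (0 < n)%N := leq_trans k0 kn.
have n0R : (0 : R) < n%:R by rewrite ltr0n.
have k0R : (0 : R) < k%:R by rewrite ltr0n.
have T1 := T_ge1 n n0.
set S := \sum_(i < n) `|x i| `^ p.
set D := k%:R + 2 * n%:R `^ (1 - p^-1).
have D0 : 0 < D by rewrite addr_gt0// mulr_gt0// powR_gt0.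
have SD : S <= n%:R `^ p^-1 * D.
  apply: (@le_trans _ _ (\sum_(i < n) ((if (i < k)%N then n%:R `^ p^-1 else 0) + 1))).
    by apply: ler_sum => i _; have [] := box_powR_le k n i (x i) n0 (xbox i (ltn_ord i)).
  rewrite big_split/= -big_mkcond/= -(big_ord_widen n (fun=> n%:R `^ p^-1))//.
  rewrite !sumr_const !card_ord -[_ *+ k]mulr_natl /D mulrDr [leLHS]addrC [leRHS]addrC.
  rewrite [_ * k%:R]mulrC lerD2r mulrCA -powRD ?(gt_eqF n0R) ?implybT//.
  rewrite addrC subrK powRr1 ?(ltW n0R)//.
  by rewrite ler_peMl ?(ltW n0R)// ler1n.
have x_ge0 i : (i < n)%N -> 0 <= x i.
  by move=> i_n; have [] := box_powR_le k n i (x i) n0 (xbox i i_n).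
have x_geT i : (i < k)%N -> T n <= x i.
  move=> ik; have := xbox i (leq_trans ik kn).
  by rewrite /box/= in_itv/= ik => /andP[].
have S0 : 0 < S.
  apply: (@lt_le_trans _ _ (`|x 0%N| `^ p)).
    by rewrite powR_gt0// normr_gt0 gt_eqF// (lt_le_trans _ (x_geT 0%N k0))//; lra.
  rewrite /S (bigD1 (Ordinal n0))//= lerDl.
  by apply: sumr_ge0 => i _; exact: powR_ge0.
set L := lpnorm n p x.
have L0 : 0 < L by rewrite /L /lpnorm powR_gt0// divr_gt0.
have := sum_pairs_ge R k n (T n / L) (fun i => x i / L) kn.
move=> /(_ ltac:(by rewrite divr_ge0//; lra)).
move=> /(_ (fun i i_n => divr_ge0 (x_ge0 i i_n) (ltW L0))).
move=> /(_ (fun i ik => ler_wpM2r (ltW (_ : 0 < L^-1)) (x_geT i ik))).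
rewrite invr_gt0 => /(_ L0) H.
rewrite /Hn ler_pdivlMr//; apply: le_trans H.
have quot : n%:R / D <= n%:R `^ p^-1 / (S / n%:R).
  rewrite ler_pdivrMr// invf_div mulrA mulrAC ler_pdivlMr//.
  by rewrite [leRHS]mulrAC mulrC ler_pM2r.
have TL : n%:R `^ p^-1 * (D `^ p^-1)^-1 <= T n / L.
  rewrite /T /L /lpnorm -/S div1r -!powRN.
  rewrite -[- p^-1]mulN1r [D `^ _]powRrM [(S / n%:R) `^ _]powRrM.
  rewrite !powR_inv1 ?divr_ge0 ?(ltW S0) ?(ltW n0R) ?(ltW D0)//.
  rewrite -!powRM ?powR_ge0 ?invr_ge0 ?divr_ge0 ?(ltW S0) ?(ltW n0R) ?(ltW D0)//.
  by apply: ge0_ler_powR; rewrite ?nnegrE ?mulr_ge0 ?powR_ge0 ?invr_ge0 ?divr_ge0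
    ?(ltW S0) ?(ltW n0R) ?(ltW D0) ?(ltW p0).
have k1R : (0 : R) <= k%:R - 1 by rewrite subr_ge0 ler1n.
rewrite -!mulrA ler_pM2l//; apply: ler_wpM2l => //.
rewrite ler_pM2l ?invr_gt0//.
have sq : (n%:R `^ p^-1 * (D `^ p^-1)^-1) ^+ 2 <= (T n / L) ^+ 2.
  rewrite ler_sqr ?nnegrE//; first by rewrite mulr_ge0 ?invr_ge0 ?powR_ge0.
  by rewrite divr_ge0 ?(ltW L0)//; lra.
apply: le_trans sq; rewrite exprMn exprVn.
have sqE (z : R) : 0 < z -> (z `^ p^-1) ^+ 2 = z `^ (2 / p).
  move=> z0; rewrite expr2 -powRD ?(gt_eqF z0) ?implybT//.
  by congr (_ `^ _); ring.
rewrite !sqE// powRN [leRHS]mulrC ler_pM2l ?invr_gt0 ?powR_gt0//.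
by rewrite powRB ?(gt_eqF n0R) ?implybT// powRr1 ?(ltW n0R)// divfK// gt_eqF.
Qed.

(** The integrand is bounded below by a constant times the indicator of the box, which has volume 1;
    e^([l i]) is the least density allowed by [box_powR_le]. *)
Lemma Znp_ge (k n : nat) : (0 < k)%N -> (k <= n)%N ->
  ((expR (beta * (k%:R * (k%:R - 1) / 2 *
      (k%:R + 2 * n%:R `^ (1 - p^-1)) `^ (- (2 / p)) * n%:R `^ (2 / p - 1))
     + (n%:R * (ln (c_p p) - p^-1) - k%:R * (n%:R `^ p^-1 / p))))%:E
   <= Znp n p beta)%E.
Proof.
move=> k0 kn; have n0 : (0 < n)%N := leq_trans k0 kn.
set A := beta * _.
pose l i : R := ln (c_p p) - p^-1 - (if (i < k)%N then n%:R `^ p^-1 / p else 0).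
pose g i (x : R) : R := expR (l i) * \1_(box k n i) x.
have g0 i x : 0 <= g i x by rewrite mulr_ge0 ?expR_ge0.
have mbox i : measurable (box k n i) by exact: measurable_itv.
have -> : (expR (A + (n%:R * (ln (c_p p) - p^-1) - k%:R * (n%:R `^ p^-1 / p)))
    = expR A * \prod_(i < n) expR (l i)).
  rewrite expRD -expR_sum; congr (_ * expR _).
  rewrite /l sumrB sumr_const card_ord mulr_natl; congr (_ - _).
  rewrite -big_mkcond/= -(big_ord_widen n (fun=> n%:R `^ p^-1 / p))//.
  by rewrite sumr_const card_ord mulr_natl.
rewrite -(@iter_int_prod _ n g (fun i => expR (l i))) ?expR_ge0//; last 2 first.
- by move=> i; apply: measurable_funM => //; exact: measurable_indic.
- by move=> i; exact: integral_indic_itv.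
apply: le_iter_int => x.
  by rewrite lee_fin mulr_ge0 ?expR_ge0// prodr_ge0.
have [xbox|] := pselect (forall i, (i < n)%N -> box k n i (x i)); last first.
  move=> /existsNP[i /not_implyP[i_n xi]].
  rewrite (bigD1 (Ordinal i_n))//= /g indicE memNset// mulr0 mul0r mulr0.
  exact: integrand_ge0.
rewrite lee_fin /integrand; apply: ler_pM; rewrite ?expR_ge0 ?prodr_ge0//.
  by rewrite ler_expR ler_pM2l//; exact: Hn_ge_box.
apply: ler_prod => i _; rewrite g0/= /g indicE mem_set ?mulr1; last exact: xbox.
have [_ xp] := box_powR_le k n i (x i) n0 (xbox i (ltn_ord i)).
rewrite /l /rho -addrA expRD lnK ?posrE ?c_p_gt0// ler_pM2l ?c_p_gt0// ler_expR.
have pV0 : 0 <= p^-1 by rewrite invr_ge0 ltW.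
have := ler_wpM2r pV0 xp; rewrite mulNr -opprD lerN2.
by case: ifP => _; rewrite mulrDl ?mul0r mul1r addrC.
Qed.

(** * Passage to the limit *)

Lemma cvg_powR_natr_0 (r : R) : 0 < r -> (fun n : nat => n%:R `^ (- r) : R) @ \oo --> 0.
Proof.
move=> r0; rewrite -cvg_shiftS.
have : (fun n : nat => `|harmonic n| `^ r) @ \oo --> `|0 : R| `^ r.
  apply: (cvg_comp (@harmonic R) (fun x : R => `|x| `^ r)); first exact: cvg_harmonic.
  exact: continuous_powR_norm.
rewrite normr0 powR0 ?gt_eqF//; apply: cvg_trans; apply: near_eq_cvg.
near=> n; rewrite /harmonic ger0_norm ?invr_ge0//.
by rewrite /= -powR_inv1// -powRrM mulN1r.
Unshelve. all: by end_near. Qed.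

Lemma cvg_Znp (k : nat) : (2 <= k)%N -> pk k.-1 < p <= pk k ->
  (fun n : nat => n%:R `^ (1 - 2 / p) * ln (fine (Znp n p beta)))
    @ \oo --> beta / 2 * tau_k k p.
Proof.
move=> k2 pkk; have k0 : (0 < k)%N by exact: ltn_trans k2.
have k0R : (0 : R) < k%:R by rewrite ltr0n.
(* All errors are expressed through e = n^(1-1/p): after multiplication by n^(1-2/p), a term n
   becomes e^2 and a term n^(1/p) becomes e. *)
pose e (n : nat) : R := n%:R `^ (1 - p^-1).
set I := fine (\int[@lebesgue_measure R]_x (rho p x)%:E)%E.
have e0 : e @ \oo --> 0.
  rewrite /e -opprB; apply: cvg_powR_natr_0.
  by rewrite subr_gt0 invf_gt1.
pose c : R := ln (c_p p) - p^-1.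
pose lo n : R := beta * (k%:R * (k%:R - 1) / 2 * (k%:R + 2 * e n) `^ (- (2 / p)))
  + (e n * e n * c - k%:R / p * e n).
pose up n : R := beta / 2 * tau_k k p + e n * e n * I.
apply: (@squeeze_cvgr _ _ _ _ lo up).
- near=> n; have kn : (k <= n)%N by near: n; exact: nbhs_infty_ge.
  have n0 : (0 < n)%N := leq_trans k0 kn.
  have n0R : (0 : R) < n%:R by rewrite ltr0n.
  have nD (a b : R) : n%:R `^ a * n%:R `^ b = n%:R `^ (a + b) :> R.
    by rewrite powRD// (gt_eqF n0R) implybT.
  have i1 : n%:R `^ (1 - 2 / p) * n%:R `^ (2 / p - 1) = 1 :> R.
    by rewrite nD (_ : _ + _ = 0) ?powRr0//; ring.
  have i2 : n%:R `^ (1 - 2 / p) * n%:R = e n * e n.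
    by rewrite -{2}(powRr1 (ltW n0R)) /e !nD; congr (_ `^ _); ring.
  have i3 : n%:R `^ (1 - 2 / p) * n%:R `^ p^-1 = e n.
    by rewrite /e nD; congr (_ `^ _); ring.
  have lb := Znp_ge k n k0 kn; have ub := Znp_le k n k2 pkk n0.
  (* Finiteness and positivity ensure that [ln (fine Z)] is the true logarithm and not a default
     value. *)
  have Zfin : Znp n p beta \is a fin_num.
    by rewrite fin_numElt (lt_le_trans _ lb) ?ltNyr// (le_lt_trans ub) ?ltry.
  rewrite -(fineK Zfin) !lee_fin in lb ub.
  have Z0 : 0 < fine (Znp n p beta) by apply: lt_le_trans lb; exact: expR_gt0.
  rewrite -{1}(lnK Z0) in lb; rewrite -(lnK Z0) in ub.
  rewrite !ler_expR in lb ub.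
  have N0 : 0 <= (n%:R : R) `^ (1 - 2 / p) := powR_ge0 _ _.
  have lb' := ler_wpM2l N0 lb; have ub' := ler_wpM2l N0 ub.
  apply/andP; split.
    apply: le_trans lb'; rewrite -/(e n) -/c.
    set Q := k%:R * (k%:R - 1) / 2 * _.
    rewrite (_ : _ * (beta * (Q * _) + _) =
      beta * Q * (n%:R `^ (1 - 2 / p) * n%:R `^ (2 / p - 1))
      + (n%:R `^ (1 - 2 / p) * n%:R * c
         - k%:R / p * (n%:R `^ (1 - 2 / p) * n%:R `^ p^-1))); last by ring.
    by rewrite i1 i2 i3 mulr1.
  apply: (le_trans ub'); rewrite -/I (_ : _ * (_ + _) =
    beta / 2 * tau_k k p * (n%:R `^ (1 - 2 / p) * n%:R `^ (2 / p - 1))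
    + n%:R `^ (1 - 2 / p) * n%:R * I); last by ring.
  by rewrite i1 i2 mulr1.
(* The limit is the lower bound with e replaced by 0, since k(k-1) k^(-2/p) = [tau_k k p]. *)
- rewrite (_ : beta / 2 * tau_k k p =
      beta * (k%:R * (k%:R - 1) / 2 * (k%:R + 2 * 0) `^ (- (2 / p)))
      + (0 * 0 * c - k%:R / p * 0)); last first.
    rewrite !(mulr0, mul0r) subrr !addr0 /tau_k powRD ?(gt_eqF k0R) ?implybT//.
    by rewrite powRr1 ?(ltW k0R)//; ring.
  apply: cvgD; last first.
    apply: cvgB; first by apply: cvgMl; exact: cvgM.
    by apply: cvgMr.
  apply: cvgMr; apply: cvgMr.
  have ke : (fun n => k%:R + 2 * e n) @ \oo --> (k%:R + 2 * 0 : R).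
    by apply: cvgD; [exact: cvg_cst|apply: cvgMr].
  apply: (cvg_comp _ (fun x : R => x `^ (- (2 / p))) ke).
  by rewrite mulr0 addr0; exact: powR_continuous.
- rewrite -[X in _ --> X]addr0; apply: cvgD; first exact: cvg_cst.
  by rewrite -(mul0r I) -{1}(mul0r 0); apply: cvgMl; exact: cvgM.
Unshelve. all: by end_near. Qed.

End Asymptotics.

Theorem theorem1p5 (R : realType) (p beta : R) (k : nat) :
  0 < p < 1 -> 0 < beta -> (2 <= k)%N -> pk k.-1 < p <= pk k ->
  (fun n : nat => n%:R `^ (1 - 2 / p) * ln (fine (Znp n p beta)))
    @ \oo --> beta / 2 * tau_k k p.
Proof. by move=> /andP[p0 p1] beta0 k2 pkk; exact: cvg_Znp. Qed.
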